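(* Let $k$ and $j$ be positive integers. For every graph $G$ with $\dim(G)=k$ and every vertex $v$ of $G$, the number of vertices $u\ne v$ with $\textnormal{dist}(u,v)\le j$ is at most $(2j+1)^k-1$; moreover, there exist a graph $G$ with $\dim(G)=k$ and a vertex $v$ of $G$ for which this number equals $(2j+1)^k-1$.
   Context: Graphs are finite, simple, undirected, possibly disconnected; $\textnormal{dist}(u,v)=\infty$ between different components. A set $S=\{v_1,\dots,v_k\}$ of vertices is a resolving set of $G$ if the vectors $(\textnormal{dist}(u,v_1),\dots,\textnormal{dist}(u,v_k))$ are pairwise distinct over $u\in V(G)$; $\dim(G)$ is the minimum size of a resolving set. *)

(* Defs.v *)
From mathcomp Require Import all_boot.

Set Implicit Arguments.
Unset Strict Implicit.
Unset Printing Implicit Defensive.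

Record sgraph := SGraph {
  vertex :> finType;
  adj : rel vertex;
  adj_sym : symmetric adj;
  adj_irrefl : irreflexive adj
}.

Section Metric.

Variable G : sgraph.
Implicit Types (u v w : G) (S : {set G}).

Definition has_walk u v (n : nat) : bool :=
  [exists p : n.-tuple G, path (@adj G) u p && (last u p == v)].

Lemma has_walkP u v n :
  reflect (exists p : seq G, [/\ size p = n, path (@adj G) u p & last u p = v])
          (has_walk u v n).
Proof.
apply: (iffP existsP) => [[p /andP[pp /eqP lp]]|[p [sp pp lp]]].
  by exists p; rewrite size_tuple.
have st : size p == n by rewrite sp.
by exists (Tuple st); rewrite /= pp lp eqxx.
Qed.

Lemma connect_walkP u v :
  reflect (exists n, has_walk u v n) (connect (@adj G) u v).
Proof.
apply: (iffP connectP) => [[p pp lp]|[n /has_walkP[p [_ pp lp]]]].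
  by exists (size p); apply/has_walkP; exists p.
by exists p.
Qed.

(* [None] stands for an infinite distance, so that two infinite distances are
   equal and differ from every finite one. *)
Definition dist u v : option nat :=
  if connect_walkP u v is ReflectT ex_walk then Some (ex_minn ex_walk)
  else None.

Definition dist_le u v (j : nat) : bool :=
  if dist u v is Some d then d <= j else false.

Lemma dist_SomeP u v d :
  dist u v = Some d <->
  has_walk u v d /\ (forall n, has_walk u v n -> d <= n).
Proof.
rewrite /dist; case: connect_walkP => [ex|nex]; last first.
  by split=> // -[wd _]; case: nex; exists d.
case: ex_minnP => m wm mmin; split=> [[<-] //|[wd dmin]].
by congr Some; apply/eqP; rewrite eqn_leq mmin ?dmin.
Qed.

Lemma dist_NoneP u v : dist u v = None <-> ~~ connect (@adj G) u v.
Proof. by rewrite /dist; case: connect_walkP. Qed.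

(* The vector of distances to S, its members being listed as in [enum S]. *)
Definition dist_vector S u : seq (option nat) := [seq dist u v | v in S].

Definition resolving S : bool := injectiveb (dist_vector S).

Lemma resolvingP S :
  reflect (forall u w, {in S, forall v, dist u v = dist w v} -> u = w)
          (resolving S).
Proof.
apply: (iffP (injectiveP (dist_vector S))) => inj u w uw; apply: inj.
  by apply/eq_in_map => v; rewrite mem_enum => /uw.
by move=> v vS; move/eq_in_map: uw; apply; rewrite mem_enum.
Qed.

Lemma resolvingT : resolving [set: G].
Proof.
apply/resolvingP => u w /(_ u (in_setT u)) duw.
have: dist u u = Some 0.
  by apply/dist_SomeP; split=> //; apply/has_walkP; exists [::].
by rewrite duw => /dist_SomeP[/has_walkP[p [/size0nil-> _ /= ->]]].
Qed.

Definition metric_dim : nat :=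
  #|[arg min_(S < [set: G] | resolving S) #|S|]|.

Lemma metric_dimP k :
  metric_dim = k <->
  (exists2 S, resolving S & #|S| = k) /\ (forall S, resolving S -> k <= #|S|).
Proof.
rewrite /metric_dim.
case: arg_minnP => [|S rS Smin]; first exact: resolvingT.
split=> [<-|[[S' rS' <-] S'min]]; first by split=> //; exists S.
by apply/eqP; rewrite eqn_leq Smin ?S'min.
Qed.

Definition punctured_ball v (j : nat) : {set G} :=
  [set u | (u != v) && dist_le u v j].

End Metric.

Arguments metric_dim : clear implicits.

(* Main.v *)
Require Import Defs.
From mathcomp Require Import all_boot.
From mathcomp Require Import zify.

Set Implicit Arguments.
Unset Strict Implicit.
Unset Printing Implicit Defensive.

(* Upper bound: if u lies within distance j of v, then dist(u, s) and dist(v, s)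
   differ by at most j for each landmark s (or are both infinite), so at most
   2j + 1 values are available per landmark.
   Extremal graph: take as vertices all vectors y of [0, 3j]^k that satisfy the
   triangle inequalities y_l <= y_i + 2j and 2j <= y_l + y_i (i <> l) imposed on
   the distances to k landmarks at mutual distance 2j, two of them being adjacent
   when they differ by at most 1 in each coordinate.  Moving every coordinate one
   unit towards a target preserves these inequalities, so distances are sup-norm
   distances; the i-th coordinate is then the distance to the landmark s_i with
   i-th coordinate 0 and the others 2j, and the cube [j, 3j]^k is the ball of
   radius j around (2j, ..., 2j).  The upper bound itself rules out a smaller
   resolving set. *)

Section Walks.

Variable G : sgraph.
Implicit Types (u v w s : G) (S : {set G}).

Lemma has_walk_cat u v w m n :
  has_walk u v m -> has_walk v w n -> has_walk u w (m + n).
Proof.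
move=> /has_walkP[p [<- pp lp]] /has_walkP[q [<- pq lq]].
apply/has_walkP; exists (p ++ q).
by rewrite size_cat cat_path last_cat lp pp pq.
Qed.

Lemma has_walk_sym u v n : has_walk u v n -> has_walk v u n.
Proof.
move=> /has_walkP[p [<- pp lp]]; apply/has_walkP.
exists (rev (belast u p)); rewrite size_rev size_belast; split=> //.
  by rewrite -lp rev_path (eq_path (e' := @adj G)) // => x y; rewrite adj_sym.
by case: p {pp} lp => [|x p] //= _; rewrite rev_cons last_rcons.
Qed.

Lemma dist_leP u v n :
  reflect (exists2 m, m <= n & has_walk u v m) (dist_le u v n).
Proof.
rewrite /dist_le; case E: (dist u v) => [d|].
  have [wd dmin] := (dist_SomeP u v d).1 E.
  by apply: (iffP idP) => [dn|[m mn /dmin dm]]; [exists d | exact: leq_trans mn].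
apply: (iffP idP) => // -[m _ wm]; move/dist_NoneP: E => /negP[].
by apply/connect_walkP; exists m.
Qed.

Lemma dist_le_refl u n : dist_le u u n.
Proof. by apply/dist_leP; exists 0 => //; apply/has_walkP; exists [::]. Qed.

Lemma dist_le_sym u v n : dist_le u v n -> dist_le v u n.
Proof. by move=> /dist_leP[m mn /has_walk_sym wm]; apply/dist_leP; exists m. Qed.

Lemma dist_le_trans u v w m n :
  dist_le u v m -> dist_le v w n -> dist_le u w (m + n).
Proof.
move=> /dist_leP[a am wa] /dist_leP[b bn wb]; apply/dist_leP.
by exists (a + b); [exact: leq_add | exact: has_walk_cat wb].
Qed.

(** The triangle inequality used both ways; finiteness also transfers, so throughout a ball the
    distances to [s] are all finite or all infinite. *)
Lemma dist_le_lipschitz u v s j d : dist_le u v j -> dist v s = Some d ->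
  exists e, [/\ dist u s = Some e, e <= d + j & d <= e + j].
Proof.
move=> uv vs.
have: dist_le u s (j + d) by apply: dist_le_trans uv _; rewrite /dist_le vs.
rewrite {1}/dist_le; case us: (dist u s) => [e|] // ej.
exists e; split=> //; first by rewrite addnC.
have: dist_le v s (j + e).
  by apply: dist_le_trans (dist_le_sym uv) _; rewrite /dist_le us.
by rewrite /dist_le vs addnC.
Qed.

Lemma resolving_punctured_ball S v j : resolving S ->
  #|punctured_ball v j| <= (2 * j + 1) ^ #|S| - 1.
Proof.
move=> /resolvingP rS.
pose val o := if o is Some d then d else 0.
(* Shifting by [j] puts the difference of distances to [u] and [v] in [0, 2j] without truncation; an
   infinite pair is encoded as [j]. *)
pose code u := [ffun i : 'I_#|S| =>
  inord (val (dist u (enum_val i)) + j - val (dist v (enum_val i))) : 'I_(2 * j).+1].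
(* The centre takes a code of its own, whence the final [- 1]. *)
pose B := v |: punctured_ball v j.
have B_near u : u \in B -> dist_le u v j.
  by rewrite !inE => /orP[/eqP->|/andP[]//]; exact: dist_le_refl.
have code_inj : {in B &, injective code}.
  move=> u w /B_near uv /B_near wv /ffunP ecode; apply: rS => s sS.
  move/(_ (enum_rank_in sS s)): ecode; rewrite !ffunE !enum_rankK_in //.
  case vs: (dist v s) => [d|].
    have [a [-> ? ?]] := dist_le_lipschitz uv vs.
    have [b [-> ? ?]] := dist_le_lipschitz wv vs.
    by move=> /(congr1 (@nat_of_ord _)); rewrite /= !inordK; try lia; move=> ?; congr Some; lia.
  have far x : dist_le x v j -> dist x s = None.
    case xs: (dist x s) => [e|] // xv.
    by have [? []] := dist_le_lipschitz (dist_le_sym xv) xs; rewrite vs.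
  by rewrite !far.
have := max_card [in code @: B].
rewrite card_in_imset // card_ffun !card_ord cardsU1 !inE eqxx /= addn1.
lia.
Qed.

End Walks.

Section Extremal.

Variables k j : nat.

Definition feasible (y : {ffun 'I_k -> 'I_(3 * j).+1}) : bool :=
  [forall i, forall l, (i != l) ==> (y l <= y i + 2 * j) && (2 * j <= y l + y i)].

Definition king_vertex : finType := {y | feasible y}.

Implicit Types (x y t : king_vertex) (i l : 'I_k).

Definition coord x i : nat := val x i.

Lemma coord_le x i : coord x i <= 3 * j.
Proof. by rewrite -ltnS ltn_ord. Qed.

Lemma coord_feasible x i l : i != l ->
  coord x l <= coord x i + 2 * j /\ 2 * j <= coord x l + coord x i.
Proof.
by move=> il; have /forallP/(_ i)/forallP/(_ l)/implyP/(_ il)/andP := valP x.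
Qed.

Lemma coord_inj x y : coord x =1 coord y -> x = y.
Proof. by move=> xy; apply/val_inj/ffunP => i; apply/val_inj/xy. Qed.

Lemma vertex_of_coord (f : 'I_k -> nat) : (forall i, f i <= 3 * j) ->
  (forall i l, i != l -> f l <= f i + 2 * j /\ 2 * j <= f l + f i) ->
  {x | coord x =1 f}.
Proof.
move=> fle ffeas; pose y := [ffun i => inord (f i) : 'I_(3 * j).+1].
have yE i : y i = f i :> nat by rewrite ffunE inordK // ltnS.
have fy : feasible y.
  apply/forallP => i; apply/forallP => l; apply/implyP => il.
  by rewrite !yE; have [-> ->] := ffeas i l il.
by exists (Sub y fy) => i; rewrite /coord SubK yE.
Qed.

(** Sup-norm distance at most [n], stated additively because subtraction on [nat] truncates. *)
Definition near x y n : bool :=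
  [forall i, (coord x i <= coord y i + n) && (coord y i <= coord x i + n)].

Lemma nearP x y n :
  reflect (forall i, coord x i <= coord y i + n /\ coord y i <= coord x i + n)
          (near x y n).
Proof.
by apply: (iffP forallP) => h i; [have /andP[] := h i | apply/andP; exact: h].
Qed.

Definition king_adj x y : bool := (x != y) && near x y 1.

Lemma king_adj_sym : symmetric king_adj.
Proof.
by move=> x y; congr andb; [rewrite eq_sym | apply: eq_forallb => i; rewrite andbC].
Qed.

Lemma king_adj_irrefl : irreflexive king_adj.
Proof. by move=> x; rewrite /king_adj eqxx. Qed.

Definition king : sgraph := SGraph king_adj_sym king_adj_irrefl.

(** Each coordinate of [t] is clamped to within one unit of that of [x]. If this broke a constraint
    that [x] satisfies, the coordinates of [t] would lie at least as far in the violating direction,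
    so [t] would break it too. *)
Lemma near_step x t n : near x t n.+1 -> exists2 y, near x y 1 & near y t n.
Proof.
move=> /nearP xt.
pose f i := minn (coord x i).+1 (maxn (coord x i).-1 (coord t i)).
have [i|i l il|y yf] := @vertex_of_coord f.
- by have := coord_le x i; have := coord_le t i; rewrite /f; lia.
- have := coord_feasible x il; have := coord_feasible t il; rewrite /f; lia.
by exists y; apply/nearP => i; rewrite yf; have := xt i; rewrite /f; lia.
Qed.

Lemma near0 x y : near x y 0 -> x = y.
Proof. by move=> /nearP xy; apply: coord_inj => i; have := xy i; lia. Qed.

Lemma king_dist_le (x t : king) n : dist_le x t n = near x t n.
Proof.
apply/idP/idP.
  move=> /dist_leP[m mn /has_walkP[p [sp pp lp]]]; rewrite -sp in mn.
  elim: p x n pp lp mn {sp} => [|y p IHp] x n /=.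
    by move=> _ -> _; apply/nearP => i; lia.
  case: n => // n /andP[/andP[_ /nearP xy]] pp lp pn; apply/nearP => i.
  by have /nearP/(_ i) := IHp y n pp lp pn; have := xy i; lia.
elim: n x => [|n IHn] x; first by move=> /near0->; exact: dist_le_refl.
move=> /near_step[y xy /IHn yt]; rewrite -add1n.
(* The step may be stationary, and there are no loops; the walk is then merely shorter. *)
apply: dist_le_trans yt; have [->|neq] := eqVneq x y; first exact: dist_le_refl.
by apply/dist_leP; exists 1 => //; apply/has_walkP; exists [:: y]; rewrite /= /king_adj neq xy.
Qed.

Lemma landmark_subproof i :
  {x | coord x =1 fun l => if l == i then 0 else 2 * j}.
Proof.
apply: vertex_of_coord => [l|l m]; first by case: ifP => _; lia.
by move=> lm; have [mi|_] := eqVneq m i; have [li|_] := eqVneq l i;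
  rewrite ?mi ?li ?eqxx in lm *; lia.
Qed.

Definition landmark i : king := sval (landmark_subproof i).

(** Feasibility for the pair [i], [l] says that [coord x l] differs from [2 * j] by at most
    [coord x i], so coordinate [i] alone decides the sup norm. *)
Lemma dist_le_landmark (x : king) i n : dist_le x (landmark i) n = (coord x i <= n).
Proof.
have sE := svalP (landmark_subproof i); rewrite king_dist_le.
apply/nearP/idP => [/(_ i)|xn l]; rewrite sE; first by rewrite eqxx; case.
case: eqVneq => [->|li]; first by lia.
by have := @coord_feasible x i l; rewrite eq_sym => /(_ li); lia.
Qed.

Lemma resolving_landmarks : resolving (landmark @: [set: 'I_k]).
Proof.
apply/resolvingP => x y xy; apply: coord_inj => i.
have le_xy n : (coord x i <= n) = (coord y i <= n).
  by rewrite -!dist_le_landmark /dist_le xy // imset_f ?in_setT.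
by apply/eqP; rewrite eqn_leq le_xy leqnn -le_xy leqnn.
Qed.

Lemma card_landmarks : #|landmark @: [set: 'I_k]| <= k.
Proof. by apply: leq_trans (leq_imset_card _ _) _; rewrite cardsT card_ord. Qed.

Lemma center_subproof : {x | coord x =1 fun=> 2 * j}.
Proof. by apply: vertex_of_coord => [l|l m]; lia. Qed.

Definition center : king := sval center_subproof.

(** Entries in [j, 3j] differ by at most 2j and sum to at least 2j, so the whole cube is
    feasible. *)
Lemma cube_subproof (z : {ffun 'I_k -> 'I_(2 * j).+1}) :
  {x | coord x =1 fun i => j + z i}.
Proof.
by apply: vertex_of_coord => [i|i l _]; have := ltn_ord (z i);
  [|have := ltn_ord (z l)]; lia.
Qed.

Lemma center_ball_ge : (2 * j + 1) ^ k - 1 <= #|punctured_ball center j|.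
Proof.
pose cube z : king := sval (cube_subproof z).
have cubeE z : coord (cube z) =1 fun i => j + z i := svalP (cube_subproof z).
have cube_inj : injective cube.
  move=> z z' ezz; apply/ffunP => i; apply/val_inj/(@addnI j).
  by rewrite -!cubeE ezz.
have: cube @: setT \subset center |: punctured_ball center j.
  apply/subsetP => _ /imsetP[z _ ->]; rewrite !inE; case: eqVneq => //= _.
  rewrite king_dist_le; apply/nearP => i.
  by rewrite cubeE (svalP center_subproof i); case: (z i) => c /= ?; lia.
move/subset_leq_card; rewrite card_imset // cardsT card_ffun !card_ord.
by rewrite cardsU1 !inE eqxx addn1 leq_subLR.
Qed.

End Extremal.

Theorem theorem28 (k j : nat) (k_gt0 : 0 < k) (j_gt0 : 0 < j) :
  (forall (G : sgraph) (v : G), metric_dim G = k ->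
     #|punctured_ball v j| <= (2 * j + 1) ^ k - 1) /\
  (exists (G : sgraph) (v : G), metric_dim G = k /\
     #|punctured_ball v j| = (2 * j + 1) ^ k - 1).
Proof.
have ball_le d (G : sgraph) (v : G) : metric_dim G = d ->
    #|punctured_ball v j| <= (2 * j + 1) ^ d - 1.
  by move=> /metric_dimP[[S rS <-] _]; exact: resolving_punctured_ball.
split=> [G v|]; first exact: ball_le.
have ge_ball := center_ball_ge k j.
have dim_k : metric_dim (king k j) = k.
  have /metric_dimP[_ dim_min] := erefl (metric_dim (king k j)).
  apply/eqP; rewrite eqn_leq.
  rewrite (leq_trans (dim_min _ (resolving_landmarks k j)) (card_landmarks k j)).
  (* As [j] is positive the base exceeds 1, so exponents compare as powers do; the ball at [center]
     is then bounded below with exponent [k] and above with the actual dimension. *)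
  rewrite -(@leq_exp2l (2 * j + 1)); last by lia.
  have := leq_trans ge_ball (ball_le _ _ (center k j) erefl).
  by rewrite leq_subLR subnKC // expn_gt0 addn1.
exists (king k j), (center k j); split=> //.
by apply/eqP; rewrite eqn_leq ge_ball ball_le.
Qed.
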